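(* Let $\delta\ge 0$ and let $X$ be a $\delta$-hyperbolike graph that is not quasi-isometric to a point or a line. Let $x$ be a base vertex and let $|X_n|$ denote the number of vertices of $X$ at distance $\le n$ from $x$. Then there are constants $\lambda>1$ and $C>1$ such that for all integers $n\ge 0$ $$C^{-1}\lambda^n \le |X_n| \le C\lambda^n .$$
   Context: A connected graph $X$ of finite valence is called $\delta$-hyperbolike (for some $\delta\ge 0$) if (1) $X$, with its path metric $d$ in which every edge has length $1$, is $\delta$-hyperbolic (each side of every geodesic triangle lies in the $\delta$-neighborhood of the union of the other two sides), and (2) the automorphism group $\mathrm{Aut}(X)$ acts transitively on the vertices of $X$. The base vertex is an arbitrary vertex. *)

(* Defs.v *)
From mathcomp Require Import all_boot all_order all_algebra finmap.
From mathcomp Require Import boolp classical_sets functions cardinality reals.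

Set Implicit Arguments.
Unset Strict Implicit.
Unset Printing Implicit Defensive.
Import Order.TTheory GRing.Theory Num.Theory.
Local Open Scope classical_set_scope.
Local Open Scope ring_scope.

(* Loops and multiple edges are allowed.  The orientation of an edge given by
   [src] and [tgt] is an arbitrary choice; automorphisms may reverse it. *)
Record graph := Graph {
  vert : choiceType;
  edge : choiceType;
  src : edge -> vert;
  tgt : edge -> vert }.

Definition finite_valence (X : graph) : Prop :=
  forall v : vert X, finite_set [set e : edge X | src e = v \/ tgt e = v].

Definition automorphism (X : graph)
    (fV : vert X -> vert X) (fE : edge X -> edge X) : Prop :=
  [/\ bijective fV, bijective fE &
      forall e : edge X,
        (src (fE e) = fV (src e) /\ tgt (fE e) = fV (tgt e)) \/
        (src (fE e) = fV (tgt e) /\ tgt (fE e) = fV (src e))].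

Definition vertex_transitive (X : graph) : Prop :=
  forall v w : vert X,
    exists fV fE, automorphism (X := X) fV fE /\ fV v = w.

(* The underlying set of the geometric realization: the vertices together with
   one open unit interval for each edge. *)
Definition realization (R : realType) (X : graph) : Type :=
  (vert X + edge X * {t : R | 0 < t < 1})%type.

Definition vertex_pt (R : realType) (X : graph) (v : vert X) :
  realization R X := inl v.

(* The characteristic map [0, 1] -> X of the edge [e]; values outside [0, 1]
   are clamped and never used. *)
Definition edge_pt (R : realType) (X : graph) (e : edge X) (t : R) :
    realization R X :=
  if insub t is Some u then inr (e, u)
  else vertex_pt R (if t <= 0 then src e else tgt e).

(* A piecewise linear path from [p] to [q]: the item [(e, (a, b))] is the
   linear piece from [edge_pt e a] to [edge_pt e b] inside the edge [e]. *)
Fixpoint pl_path (R : realType) (X : graph) (p q : realization R X)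
    (s : seq (edge X * (R * R))) : Prop :=
  match s with
  | [::] => p = q
  | (e, (a, b)) :: s' =>
      [/\ 0 <= a <= 1, 0 <= b <= 1, edge_pt e a = p
        & pl_path (edge_pt e b) q s']
  end.

Definition pl_length (R : realType) (X : graph)
    (s : seq (edge X * (R * R))) : R :=
  \sum_(i <- s) `|i.2.2 - i.2.1|.

(* Meaningful only when [p] and [q] are joined by a path, since [inf set0] is
   [0]. *)
Definition path_dist (R : realType) (X : graph) (p q : realization R X) : R :=
  inf [set pl_length s | s in [set s | pl_path p q s]].

Definition graph_connected (R : realType) (X : graph) : Prop :=
  forall p q : realization R X, exists s, pl_path p q s.

Section MetricNotions.
Variable R : realType.

Definition geodesic_segment (T : Type) (d : T -> T -> R) (p q : T)
    (S : set T) : Prop :=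
  exists (L : R) (c : R -> T),
    [/\ 0 <= L, c 0 = p, c L = q,
        (forall s t : R, 0 <= s <= L -> 0 <= t <= L ->
           d (c s) (c t) = `|s - t|)
      & S = [set c t | t in [set t | 0 <= t <= L]]].

(* Closed, so that [0]-hyperbolicity makes sense; for compact [S] this is the
   set of points at infimum distance at most [r] from [S]. *)
Definition neighborhood (T : Type) (d : T -> T -> R) (r : R) (S : set T) :
  set T := [set p | exists2 q, S q & d p q <= r].

Definition gromov_hyperbolic (T : Type) (d : T -> T -> R) (delta : R) : Prop :=
  forall (x y z : T) (A B C : set T),
    geodesic_segment d x y A -> geodesic_segment d y z B ->
    geodesic_segment d z x C ->
    [/\ A `<=` neighborhood d delta (B `|` C),
        B `<=` neighborhood d delta (C `|` A)
      & C `<=` neighborhood d delta (A `|` B)].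

Definition quasi_isometric (T U : Type) (dT : T -> T -> R) (dU : U -> U -> R) :
    Prop :=
  exists (f : T -> U) (K C : R),
    [/\ 1 <= K, 0 <= C,
        (forall p q : T, K^-1 * dT p q - C <= dU (f p) (f q) <= K * dT p q + C)
      & forall u : U, exists p : T, dU u (f p) <= C].

Definition point_dist (_ _ : unit) : R := 0.

Definition line_dist (s t : R) : R := `|s - t|.

End MetricNotions.

Definition hyperbolike (R : realType) (delta : R) (X : graph) : Prop :=
  [/\ graph_connected R X, finite_valence X,
      gromov_hyperbolic (@path_dist R X) delta
    & vertex_transitive X].

Definition vertex_ball (R : realType) (X : graph) (x : vert X) (n : nat) :
  set (vert X) :=
  [set v | path_dist (vertex_pt R x) (vertex_pt R v) <= n%:R].

(* Main.v *)
(** Let [b n] and [s n] be the sizes of the ball and of the sphere of radius [n]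
in the vertex set, and write [(y|z)_o] for the Gromov product.  Since ball sizes
do not depend on the centre, [b (m + n) <= b m * b n]; hence
[lambda := inf_n b n ^ (1 / n)] satisfies [lambda ^ n <= b n].

For the upper bound let [cone x o n] be the set of the points [z] of the ball of
radius [n] about [o] with [(x|z)_o] bounded by a constant.  If [X] is neither
bounded nor a quasi-line, some geodesic triangles are close to tripods with
arbitrarily long legs; by transitivity every vertex is the centre of such a
tripod, and at least two of its legs point away from a given [x].
Let [a] be the end of such a leg, of length [L].  The ball of
radius [n] about [a] is contained in the union of [cone x o (n + L)] and of the
ball of radius [n - L + c] about [o], whence
[b n <= |cone x o (n + L)| + b (n - L + c)].  Using both legs,
[|cone x o (n + L)|] is at least twice the least size of a cone of radius [n].
So the sum obtained by iterating the first estimate is dominated by a geometric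
series and [b n <= 2 |cone x o (n + L')|], uniformly in [x] and [o].

Finally, attach to each [y] on the sphere of radius [m] about [o] the cone at
[y] pointing away from [o].  These cones overlap boundedly often, so
[s m * b n <= T * b (m + n)].  This forces [s m <= T * lambda ^ m], and summing
over [m] gives the upper bound; [lambda > 1] because cones double. *)
Require Import Defs.
From mathcomp Require Import all_boot all_order all_algebra finmap.
From mathcomp Require Import boolp classical_sets functions cardinality reals.
From mathcomp Require Import exp zify lra.

Set Implicit Arguments.
Unset Strict Implicit.
Unset Printing Implicit Defensive.
Import Order.TTheory GRing.Theory Num.Theory.

(** * Gromov products in a slim integer-valued geodesic metric *)

Section GromovProduct.
Local Open Scope nat_scope.
Variables (V : choiceType) (d : V -> V -> nat) (D : nat).

(* Twice the usual Gromov product, so that it is an integer. *)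
Definition gprod (o x y : V) : nat := d o x + d o y - d x y.

Hypothesis dxx : forall x, d x x = 0.
Hypothesis dC : forall x y, d x y = d y x.
Hypothesis dtri : forall x y z, d x z <= d x y + d y z.
Hypothesis d_geod : forall x y i, i <= d x y ->
  exists2 p, d x p = i & d p y = d x y - i.

Definition between (x p y : V) : Prop := d x p + d p y = d x y.

Hypothesis d_slim : forall x y z p, between x p y ->
  exists2 q, d p q <= D & between x q z \/ between y q z.

Lemma gprodC o x y : gprod o x y = gprod o y x.
Proof. by rewrite /gprod (dC x) addnC. Qed.

Lemma gprod_le_dist o x y p : between x p y -> gprod o x y <= (d o p).*2.
Proof.
rewrite /between /gprod => pxy; have := dtri o p x; have := dtri o p y.
have := dC p x; lia.
Qed.

(** Converse of [gprod_le_dist] up to a constant: [gprod d o x y] is roughly twice the distance from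
    [o] to a geodesic [x, y]. *)
Lemma dist_le_gprod o x y :
  exists2 p, between x p y & (d o p).*2 <= gprod o x y + 4 * D.+1.
Proof.
(* The last point of [x, y] close to [o, x] is also close to [o, y]. *)
pose near_ox i := `[< exists p q, [/\ between x p y, d x p = i,
  d p q <= D & between x q o] >].
have ex0 : exists i, near_ox i.
  exists 0; apply/asboolP; exists x, x.
  by rewrite /between !dxx; split; lia.
have ub i : near_ox i -> i <= d x y.
  by move=> /asboolP[p [q [pxy <- _ _]]]; move: pxy; rewrite /between; lia.
case: (ex_maxnP ex0 ub) => i /asboolP[p [q [pxy xpi pq qxo]]] imax.
have [p' p'y [r [pr ro]]] : exists2 p', d p p' <= 1 & exists r,
    d p' r <= D /\ between y r o.
  have [py0|py0] := eqVneq (d p y) 0.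
    exists y; first by rewrite py0.
    by exists y; rewrite /between !dxx.
  have [p' pp' p'y] : exists2 p', d p p' = 1 & d p' y = d p y - 1.
    by apply: d_geod; lia.
  exists p'; first by rewrite pp'.
  have := dtri x p p'; have := dtri x p' y; move: (pxy); rewrite /between.
  move=> ? ? ?; have p'xy : between x p' y by rewrite /between; lia.
  (* Closeness of [p'] to [x, o] would contradict the maximality of [i]. *)
  have [r p'r [rx|ry]] := d_slim o p'xy; last by exists r.
  have : near_ox i.+1 by apply/asboolP; exists p', r; split => //; lia.
  by move/imax; lia.
exists p => //; move: pxy qxo ro; rewrite /between /gprod.
have := dtri o q p; have := dtri x q p; have := dtri x p q.
have := dtri o r p; have := dtri y r p; have := dtri p p' r.
have := dC q p; have := dC r p; have := dC p x; have := dC o p; have := dC q o.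
have := dC r o; have := dC o x; have := dC o y; have := dC p y.
have := dtri p q x; have := dtri p r y; have := dC q x; have := dC r y; lia.
Qed.

(** A point between [x] and [z] almost realizes their product; slimness moves it by [D] onto a side
    ending at [y], where its distance to [o] bounds another product. The constant is 4(D + 1) +
    2D. *)
Lemma gprod_hyperbolic o x y z :
  minn (gprod o x y) (gprod o y z) <= gprod o x z + (6 * D + 4).
Proof.
have [p pxz op] := dist_le_gprod o x z.
have [q pq [xqy|zqy]] := d_slim y pxz.
  have := gprod_le_dist o xqy; have := dtri o p q; lia.
have := gprod_le_dist o zqy; have := dtri o p q; rewrite gprodC; lia.
Qed.

End GromovProduct.

(** * Spaces without fat triangles *)

Section LineLike.
Local Open Scope nat_scope.
Variables (V : choiceType) (d : V -> V -> nat) (K N : nat).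

Hypothesis dC : forall x y, d x y = d y x.
Hypothesis dtri : forall x y z, d x z <= d x y + d y z.
Hypothesis d_geod : forall x y i, i <= d x y ->
  exists2 p, d x p = i & d p y = d x y - i.
Hypothesis d_hyp : forall o x y z,
  minn (gprod d o x y) (gprod d o y z) <= gprod d o x z + K.
Hypothesis d_trans : forall u v, exists g : V -> V,
  [/\ injective g, g u = v & forall x y, d (g x) (g y) = d x y].
Hypothesis thin_triple : forall x y z,
  gprod d x y z < N \/ gprod d y z x < N \/ gprod d z x y < N.
Hypothesis unbounded : forall o n, exists u, n <= d o u.

Local Notation C := (10 * (N + K)).

(* [side u] tells whether [u] lies on the same side of [o] as a far away point
   [a]; the coordinate of [u] is then [d o u] up to this sign. *)
Lemma line_coordinate o : exists side : pred V,
  [/\ forall u v, side u = side v ->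
        d u v <= (d o u - d o v) + (d o v - d o u) + C,
      forall u v, side u != side v -> d o u + d o v <= d u v + C,
      forall l, C < 2 * l -> exists2 u, side u & d o u = l
    & forall l, C < 2 * l -> exists2 u, ~~ side u & d o u = l].
Proof.
have [a oa] := unbounded o (4 * (N + K)).
pose side u := N + K < gprod d o u a; exists side.
have same u v : side u = side v ->
    d u v <= (d o u - d o v) + (d o v - d o u) + C.
  rewrite /side.
  case: (ltnP _ (gprod d o u a)) => su;
    case: (ltnP _ (gprod d o v a)) => sv // _.
    move: su sv; have := d_hyp o u a v; rewrite (gprodC dC o a v) /gprod.
    have := thin_triple o u v; have := dtri o u v; have := dtri o v u.
    by have := dC u v; have := dC o u; have := dC o v; rewrite /gprod; lia.
  (* Both products with [a] are small. If that of [u] and [v] is small too, the triangle [a], [u],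
     [v] would be fat unless [u] or [v] is close to [o]. *)
  move: su sv; have := thin_triple o u v; have := thin_triple a u v.
  have := dtri o u v; have := dtri o v u; have := dtri u o v.
  have := dC u v; have := dC o u; have := dC o v; have := dC o a.
  have := dC u a; have := dC v a; have := dtri u o a; have := dtri v o a.
  have := dtri u v a; have := dtri v u a; have := dtri o u a.
  by have := dtri o v a; rewrite /gprod; lia.
have diff u v : side u != side v -> d o u + d o v <= d u v + C.
  suff h u' v' : side u' -> ~~ side v' -> d o u' + d o v' <= d u' v' + C.
    have [su|su] := boolP (side u); have [sv|sv] := boolP (side v) => // _.
      exact: h.
    by rewrite addnC (dC u); apply: h.
  (* Either the product of [u'] and [v'] is small, or that of [u'] and [a] is barely above the
     threshold; then thinness puts [u'] close to [o], as [a] is far. *)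
  rewrite /side -leqNgt; have := d_hyp o v' u' a.
  have := thin_triple o u' a; have := dC o u'; have := dC o v'.
  have := dC u' v'; have := dC u' a; have := dC o a; have := dtri o u' v'.
  have := dtri u' o v'; have := dtri u' o a; have := dtri o u' a.
  have := dtri o v' a; have := dtri v' o a; have := dtri u' a o.
  by rewrite /gprod; lia.
(* By homogeneity [o] is the midpoint of a geodesic of length [2 * l]; for [C < 2 * l] its ends
   cannot be on the same side. *)
have ends l : exists p q, [/\ d o p = l, d o q = l & d p q = 2 * l].
  have [u ou] := unbounded o (2 * l).
  have [w ow wu] := d_geod ou.
  have [|y oy yw] := @d_geod o w l; first by lia.
  have [g [_ gy gd]] := d_trans y o.
  have go z : d o (g z) = d y z by rewrite -{1}gy gd.
  by exists (g o), (g w); rewrite !go gd (dC y o); split; lia.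
split=> // l lC; have [p [q [op oq pq]]] := ends l.
  have [sp|sp] := boolP (side p); first by exists p.
  exists q => //; apply/negPn/negP => sq.
  by have := same p q; rewrite (negPf sp) (negPf sq) => /(_ erefl); lia.
have [sp|sp] := boolP (side p); last by exists p.
exists q => //; apply/negP => sq.
by have := same p q; rewrite sp sq => /(_ erefl); lia.
Qed.

End LineLike.

(** * Pure exponential growth of a sequence *)

Section PureExponential.
Local Open Scope ring_scope.
Variable R : realType.

Definition nth_root (n : nat) (a : R) : R := a `^ n%:R^-1.

Lemma nth_root_ge0 n a : 0 <= nth_root n a.
Proof. exact: powR_ge0. Qed.

Lemma nth_rootK n a : (0 < n)%N -> 0 <= a -> nth_root n a ^+ n = a.
Proof.
move=> n0 a0; rewrite -powR_mulrn ?nth_root_ge0 // -powRrM mulVf ?powRr1 //.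
by rewrite pnatr_eq0 -lt0n.
Qed.

Lemma le_nth_root n m a b : (0 < n)%N -> (0 < m)%N -> 0 <= a -> 0 <= b ->
  a ^+ n <= b ^+ m -> nth_root m a <= nth_root n b.
Proof.
move=> n0 m0 a0 b0 ab.
have nm0 : (0 < n * m)%N by rewrite muln_gt0 n0.
rewrite -(ler_pXn2r nm0) ?nnegrE ?nth_root_ge0 //.
by rewrite mulnC exprM nth_rootK // mulnC exprM nth_rootK.
Qed.

(* The rate is the infimum of the [b n ^ (1 / n)].  Submultiplicativity makes it
   a lower bound; the reverse inequality for [s] makes every
   [(s m / T) ^ (1 / m)] at most every [b n ^ (1 / n)], and [b] is recovered from
   [s] by summing a geometric series. *)
Lemma pure_exponential (b s : nat -> nat) (T L : nat) :
  (0 < L)%N -> (0 < b 0)%N ->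
  (forall m n, b (m + n) <= b m * b n)%N ->
  (forall m n, s m * b n <= T * b (m + n))%N ->
  (forall n, b n <= \sum_(m < n.+1) s m)%N ->
  (forall j, 2 ^ j <= b (j * L))%N ->
  exists lambda C : R, [/\ 1 < lambda, 1 < C &
    forall n : nat, C^-1 * lambda ^+ n <= (b n)%:R <= C * lambda ^+ n].
Proof.
move=> L0 b00 bD sb bs b2.
have s0T : (s 0 <= T)%N by have := sb 0 0; rewrite addn0 leq_pmul2r.
have T0 : (0 < T)%N.
  by apply: leq_trans b00 (leq_trans (bs 0) _); rewrite big_ord1.
have bM n m : (0 < m)%N -> (b (m * n) <= b n ^ m)%N.
  elim: m => // -[_ _|m IH _]; first by rewrite mul1n expn1.
  by rewrite mulSn expnS (leq_trans (bD _ _)) // leq_mul2l IH ?orbT.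
(* Each factor [s m] is traded for a factor [T] and a shift of the argument of [b] by [m]. *)
have sX m n : (s m ^ n <= T ^ n * b (n * m))%N.
  elim: n => [|n IH]; first by rewrite !expn0 mul1n mul0n.
  rewrite !expnS mulSn; apply: leq_trans (leq_mul (leqnn _) IH) _.
  by rewrite mulnCA -mulnA [leqRHS]mulnCA leq_mul2l sb orbT.
pose root n := nth_root n (b n)%:R.
(* The shift leaves out the meaningless root of order 0. *)
pose A := [set root n.+1 | n in [set: nat]]%classic.
have rootA n : (0 < n)%N -> A (root n) by case: n => // n _; exists n.
have lbA t : (forall n, (0 < n)%N -> t <= root n) -> t <= inf A.
  move=> h; apply: lb_le_inf; first by exists (root 1); apply: rootA.
  by move=> _ [n _ <-]; apply: h.
have Aroot n : (0 < n)%N -> inf A <= root n.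
  move=> n0; apply: ge_inf (rootA n n0).
  by exists 0 => _ [k _ <-]; apply: nth_root_ge0.
(* From [2 ^ n <= b (n * L) <= b n ^ L], every root is at least the [L]-th root of 2. *)
have two_lt : 1 < inf A.
  apply: (@lt_le_trans _ _ (nth_root L 2)).
    rewrite -(@ltr_pXn2r _ L) ?nnegrE ?nth_root_ge0 //.
    by rewrite nth_rootK // expr1n ltr1n.
  apply: lbA => n n0; apply: le_nth_root => //.
  by rewrite -!natrX ler_nat (leq_trans (b2 n)) // mulnC bM.
set l := inf A in two_lt lbA Aroot.
have l0 : 0 < l by lra.
have lb n : l ^+ n <= (b n)%:R.
  case: n => [|n]; first by rewrite expr0 ler1n.
  rewrite -[leRHS](@nth_rootK n.+1) //.
  by apply: lerXn2r; rewrite ?nnegrE ?nth_root_ge0 ?Aroot // ltW.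
have sl m : (s m)%:R <= T%:R * l ^+ m.
  case: m => [|m]; first by rewrite expr0 mulr1 ler_nat.
  have T0R : 0 < T%:R :> R by rewrite ltr0n.
  rewrite mulrC -ler_pdivrMr // -[leLHS](@nth_rootK m.+1) ?divr_ge0 //.
  apply: lerXn2r; rewrite ?nnegrE ?nth_root_ge0 // ?(ltW l0) //.
  apply: lbA => n n0; apply: le_nth_root => //; first by rewrite divr_ge0.
  rewrite exprMn exprVn ler_pdivrMr ?exprn_gt0 // -!natrX -natrM ler_nat.
  by rewrite (leq_trans (sX _ _)) // mulnC leq_mul2r mulnC bM ?orbT.
(* The second term bounds the geometric sum; adding 1 makes [C > 1], so that [C^-1] serves below. *)
pose C := 1 + T%:R * (l / (l - 1)).
have C1 : 1 < C.
  by rewrite ltrDl mulr_gt0 ?ltr0n // divr_gt0 // subr_gt0.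
exists l, C; split=> // n; apply/andP; split.
  apply: le_trans (lb n); rewrite ler_piMl ?exprn_ge0 ?(ltW l0) //.
  by rewrite invf_le1 ?(ltW C1) // (lt_trans ltr01 C1).
apply: (@le_trans _ _ (\sum_(m < n.+1) T%:R * l ^+ m)).
  apply: (@le_trans _ _ (\sum_(m < n.+1) s m)%N%:R); first by rewrite ler_nat.
  by rewrite natr_sum ler_sum.
have geo : \sum_(m < n.+1) l ^+ m = (l ^+ n.+1 - 1) / (l - 1).
  by rewrite subrX1 mulrC mulKf // subr_eq0 gt_eqF.
rewrite -mulr_sumr geo [leRHS]mulrDl -[leLHS]add0r.
rewrite lerD ?mul1r ?exprn_ge0 ?(ltW l0) // -mulrA ler_wpM2l // mulrAC -exprS.
by rewrite ler_pM2r ?invr_gt0 ?subr_gt0 // gerBl.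
Qed.

End PureExponential.

(** * Growth of balls *)

(** Both sides are compared with the number of related pairs. *)
Lemma double_count_le (S T : choiceType) (A : {fset S}) (B : {fset T})
    (r : S -> T -> bool) (M q : nat) :
  (forall a, a \in A -> (M <= #|` [fset b in B | r a b]%fset|)%N) ->
  (forall b, b \in B -> (#|` [fset a in A | r a b]%fset| <= q)%N) ->
  (#|` A| * M <= #|` B| * q)%N.
Proof.
have cardE (U : choiceType) (E : {fset U}) (P : pred U) :
    #|` [fset u in E | P u]%fset| = (\sum_(u <- E) P u)%N.
  rewrite card_fset_sum1 big_fset /= big_mkcond.
  by apply: eq_bigr => u _; case: (P u).
move=> hA hB.
apply: (@leq_trans (\sum_(a <- A) \sum_(b <- B) r a b)%N).
  rewrite card_fset_sum1 big_distrl /= big_seq [leqRHS]big_seq.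
  by apply: leq_sum => a aA; rewrite mul1n -cardE hA.
rewrite exchange_big /= card_fset_sum1 big_distrl /= big_seq [leqRHS]big_seq.
by apply: leq_sum => b bB; rewrite mul1n -(cardE _ A (r^~ b)) hB.
Qed.

Section Growth.
Local Open Scope fset_scope.
Local Open Scope nat_scope.
Variables (V : choiceType) (d : V -> V -> nat) (K : nat).
Variable ball : V -> nat -> {fset V}.

Hypothesis dxx : forall x, d x x = 0.
Hypothesis dC : forall x y, d x y = d y x.
Hypothesis dtri : forall x y z, d x z <= d x y + d y z.
Hypothesis d_geod : forall x y i, i <= d x y ->
  exists2 p, d x p = i & d p y = d x y - i.
Hypothesis d_hyp : forall o x y z,
  minn (gprod d o x y) (gprod d o y z) <= gprod d o x z + K.
Hypothesis d_trans : forall u v, exists g : V -> V,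
  [/\ injective g, g u = v & forall x y, d (g x) (g y) = d x y].
Hypothesis fat_triple : forall N, exists x y z,
  [/\ N <= gprod d x y z, N <= gprod d y z x & N <= gprod d z x y].
Hypothesis in_ball : forall o n z, (z \in ball o n) = (d o z <= n).

(** The centre [p] is the point of [x, y] where the inscribed circle of a fat triangle would touch;
    the legs start geodesics from [p] to the corners. Shortening legs does not increase products;
    the 2 absorbs rounding. *)
Lemma tripod L o : exists a1 a2 a3,
  [/\ d o a1 = L, d o a2 = L & d o a3 = L] /\
  [/\ gprod d o a1 a2 <= K + 2, gprod d o a2 a3 <= K + 2
    & gprod d o a3 a1 <= K + 2].
Proof.
(* As [gprod] is doubled, this puts [p] at distance at least [L] from each corner. *)
have [x [y [z [Nx Ny Nz]]]] := fat_triple L.*2.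
have [p xp py] : exists2 p, d x p = (gprod d x y z)./2
    & d p y = d x y - (gprod d x y z)./2.
  apply: d_geod; rewrite /gprod; have := dtri x y z; have := dtri y x z.
  have := dtri x z y; have := dC z y; have := dC y x; lia.
have shorten q : L <= d p q -> exists2 a, d p a = L & d a q = d p q - L.
  exact: d_geod.
have [a1 pa1 a1x] : exists2 a, d p a = L & d a x = d p x - L.
  by apply: shorten; rewrite dC xp; lia.
have [a2 pa2 a2y] : exists2 a, d p a = L & d a y = d p y - L.
  apply: shorten; move: Ny Nx; rewrite py /gprod.
  have := dC x y; have := dC x z; have := dC y z.
  have := dtri x y z; have := dtri x z y; have := dtri y x z; lia.
have [a3 pa3 a3z] : exists2 a, d p a = L & d a z = d p z - L.
  apply: shorten; have := dtri x p z; move: Nx Nz; rewrite xp /gprod.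
  have := dC x y; have := dC x z; have := dC y z.
  have := dtri x y z; have := dtri x z y; have := dtri y x z; lia.
(* Four-point form of hyperbolicity; it bounds [d p z] from above. *)
have four : d p z + d x y <= maxn (d p x + d y z) (d p y + d x z) + K.
  have := d_hyp z x p y; rewrite /gprod.
  have := dC p x; have := dC p y; have := dC p z; have := dC x y.
  have := dC x z; have := dC y z; have := dtri z x y.
  have := dtri z x p; have := dtri x p z; have := dtri z p x.
  have := dtri z p y; have := dtri z y p; have := dtri p z y.
  have := dtri x z p; have := dtri x z y; lia.
have [g [_ gp gd]] := d_trans p o.
exists (g a1), (g a2), (g a3); rewrite /gprod -gp !gd pa1 pa2 pa3; split=> //.
have := dC x p; have := dC y p; have := dC z p; have := dC x y.
have := dC x z; have := dC y z; have := dtri x y z; have := dtri x z y.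
have := dtri y x z.
have := dtri x a1 a2; have := dtri x a2 y; have := dC x a1.
have := dtri y a2 a3; have := dtri y a3 z; have := dC y a2.
have := dtri z a3 a1; have := dtri z a1 x; have := dC z a3.
move: Nx Ny Nz four; rewrite /gprod in xp py *; move=> *.
by split; lia.
Qed.

(** If [x] had large products with two legs, hyperbolicity would give these legs a large product
    with each other. *)
Lemma two_legs L o x : exists a1 a2,
  [/\ d o a1 = L, d o a2 = L, gprod d o a1 a2 <= K + 2,
      gprod d o x a1 <= 2 * K + 2 & gprod d o x a2 <= 2 * K + 2].
Proof.
have [a1 [a2 [a3 [[oa1 oa2 oa3] [a12 a23 a31]]]]] := tripod L o.
have := d_hyp o a1 x a2; have := d_hyp o a2 x a3; have := d_hyp o a3 x a1.
rewrite !(gprodC dC o _ x) => h31 h23 h12.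
have [x1|x1] := leqP (gprod d o x a1) (2 * K + 2); last first.
  by exists a2, a3; split => //; lia.
have [x2|x2] := leqP (gprod d o x a2) (2 * K + 2).
  by exists a1, a2; split => //; lia.
by exists a3, a1; split => //; lia.
Qed.

Lemma gprod_flip o a z : gprod d o a z + gprod d a o z = 2 * d o a.
Proof.
rewrite /gprod; have := dC o a; have := dtri o a z; have := dtri a o z.
have := dtri o z a; have := dC a z; lia.
Qed.

(** The bound [2 * K + 2] of [two_legs] plus one loss of [K], as [gprod_turn] requires. *)
Local Notation k := (3 * K + 2).

Definition cone (x o : V) (n : nat) : {fset V} :=
  [fset z in ball o n | gprod d o x z <= k].

Lemma in_cone x o n z :
  (z \in cone x o n) = (d o z <= n) && (gprod d o x z <= k).
Proof. by rewrite !inE in_ball. Qed.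

Lemma gprod_turn o x a z : gprod d o x a <= 2 * K + 2 ->
  k < gprod d o a z -> gprod d o x z <= k.
Proof.
by move=> xa az; have := d_hyp o x z a; rewrite (gprodC dC o z a); lia.
Qed.

(** The cones at the ends of two legs of length [k.+1], pointing away from [o], are disjoint and lie
    in the larger cone. The ratio of [B] to [C] is a uniform lower bound for cones. *)
Lemma cone_double B C n :
  (forall x o, B <= C * #|` cone x o n|) ->
  forall x o, 2 * B <= C * #|` cone x o (n + k.+1)|.
Proof.
move=> hB x o; have [a1 [a2 [oa1 oa2 a12 xa1 xa2]]] := two_legs k.+1 o x.
suff le12 : #|` cone o a1 n| + #|` cone o a2 n| <= #|` cone x o (n + k.+1)|.
  by have := hB o a1; have := hB o a2; nia.
have sub a : d o a = k.+1 -> gprod d o x a <= 2 * K + 2 ->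
    (* A product at most [k] at [a] becomes one above [k] at [o], since [2 * d o a = 2 * k + 2]. *)
    cone o a n `<=` cone x o (n + k.+1).
  move=> oa xa; apply/fsubsetP => z; rewrite !in_cone => /andP[az oz].
  apply/andP; split; first by have := dtri o a z; lia.
  by apply: gprod_turn xa _; have := gprod_flip o a z; lia.
have disj : cone o a1 n `&` cone o a2 n = fset0.
  apply/fsetP => z; rewrite in_fsetI !in_cone inE; apply/negbTE/negP.
  move=> /andP[/andP[a1z oz1] /andP[a2z oz2]].
  have := gprod_flip o a1 z; have := gprod_flip o a2 z.
  by have := d_hyp o a1 z a2; rewrite (gprodC dC o z a2); lia.
rewrite -cardfsUI disj cardfs0 addn0.
by apply/fsubset_leq_card; rewrite fsubUset !sub.
Qed.

Lemma card_ball u v n : #|` ball u n| = #|` ball v n|.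
Proof.
suff le u' v' : #|` ball u' n| <= #|` ball v' n|.
  by apply/eqP; rewrite eqn_leq !le.
have [g [ginj <- gd]] := d_trans u' v'.
rewrite -(card_imfset imfset_key (mem (ball u' n)) ginj).
apply/fsubset_leq_card/fsubsetP => _ /imfsetP[z /= zu ->].
by move: zu; rewrite !in_ball gd.
Qed.

Lemma card_ballD o m n : #|` ball o (m + n)| <= #|` ball o m| * #|` ball o n|.
Proof.
apply: leq_trans (_ : #|` \bigcup_(y <- ball o m) ball y n| <= _).
  apply/fsubset_leq_card/fsubsetP => z; rewrite in_ball => oz.
  (* The minimum covers points [z] already in the ball of radius [m]. *)
  have [|y oy yz] := @d_geod o z (minn m (d o z)); first by lia.
  by apply/bigfcupP; exists y; rewrite in_ball; lia.
rewrite (card_fset_sum1 (ball o m)) big_distrl /=.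
elim/big_ind2: _ => [|A1 n1 A2 n2 le1 le2|y _]; first by rewrite cardfs0.
  by apply: leq_trans (leq_add le1 le2); rewrite cardfsU leq_subr.
by rewrite mul1n (card_ball y o).
Qed.

(* A point of [ball a n] outside the cone at [o] lies behind [o] as seen from
   [a], hence is closer to [o] than to [a]. *)
Lemma card_ball_split x o n :
  #|` ball o n| <= #|` cone x o (n + (2 * k).+1)|
    + (if k < n then #|` ball o (n - k.+1)| else 0).
Proof.
(* With this length, a product at most [k] at [o] yields [d o z <= d a z - k.+1]. *)
have [a [_ [oa _ _ xa _]]] := two_legs (2 * k).+1 o x.
have far z : d a z <= n -> k < gprod d o a z \/ k < n /\ d o z <= n - k.+1.
  move=> az; have [|az'] := ltnP k (gprod d o a z); [by left|right].
  by move: az'; rewrite /gprod; lia.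
rewrite (card_ball o a); set E := cone _ _ _.
have far_cone z : d a z <= n -> k < gprod d o a z -> z \in E.
  move=> az oz; rewrite in_cone (gprod_turn xa oz) andbT.
  by have := dtri o a z; lia.
case: ifP => [kn|/negbT kn].
  apply: leq_trans (_ : #|` E `|` ball o (n - k.+1)| <= _); last first.
    by rewrite cardfsU leq_subr.
  apply/fsubset_leq_card/fsubsetP => z; rewrite in_ball inE in_ball => az.
  by case: (far z az) => [/(far_cone z az) -> //|[_ ->]]; rewrite orbT.
rewrite addn0; apply/fsubset_leq_card/fsubsetP => z; rewrite in_ball => az.
by case: (far z az) => [/(far_cone z az)|[]] //; rewrite (negPf kn).
Qed.

(** Induction on the radius: doubling the cones that control the ball of radius [n - k.+1] shows
    that this ball takes at most one copy of the cone in [card_ball_split]. *)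
Lemma card_ball_le_cone n x o :
  #|` ball o n| <= 2 * #|` cone x o (n + (2 * k).+1)|.
Proof.
elim/ltn_ind: n x o => n IH x o; apply: leq_trans (card_ball_split x o n) _.
case: ifP => [kn|_]; last by lia.
suff : 2 * #|` ball o (n - k.+1)| <= 2 * #|` cone x o (n + (2 * k).+1)|.
  by lia.
have -> : n + (2 * k).+1 = n - k.+1 + (2 * k).+1 + k.+1 by lia.
refine (cone_double _ x o) => x' o'; rewrite (card_ball o o').
by apply: IH; lia.
Qed.

Lemma exp2_le_card_cone j x o : 2 ^ j <= #|` cone x o (j * k.+1)|.
Proof.
elim: j x o => [|j IH] x o.
  rewrite cardfs_gt0; apply/fset0Pn; exists o.
  by rewrite in_cone dxx /gprod dxx (dC x); lia.
rewrite expnS (mulSnr j) -[leqRHS]mul1n; refine (cone_double _ x o) => x' o'.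
by rewrite mul1n.
Qed.

(** * Spheres and the reverse inequality *)

Definition sphere o m : {fset V} := [fset y in ball o m | d o y == m].

Lemma in_sphere o m y : (y \in sphere o m) = (d o y == m).
Proof. by rewrite !inE in_ball; lia. Qed.

Lemma card_ball_sphere o n :
  #|` ball o n| <= \sum_(m < n.+1) #|` sphere o m|.
Proof.
elim: n => [|n IH].
  rewrite big_ord1; apply/fsubset_leq_card/fsubsetP => y.
  by rewrite in_sphere in_ball /= leqn0.
rewrite big_ord_recr /=; apply: leq_trans (leq_add IH (leqnn _)).
apply: leq_trans (_ : #|` ball o n `|` sphere o n.+1| <= _); last first.
  by rewrite cardfsU leq_subr.
apply/fsubset_leq_card/fsubsetP => y; rewrite in_fsetU in_sphere !in_ball.
by lia.
Qed.

(* If [z] lies in the cones at [y] and at [y'], both points are close to the point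
   at distance [m] from [o] on a geodesic from [o] to [z]. *)
Lemma card_sphere_cone o m n M :
  (forall y, M <= #|` cone o y n|) ->
  #|` sphere o m| * M <= #|` ball o (m + n)| * #|` ball o (k + K)|.
Proof.
move=> hM; apply: (double_count_le (r := fun y z =>
    (d y z <= n) && (gprod d y o z <= k))) => [y|z zb].
  rewrite in_sphere => /eqP oy; apply: leq_trans (hM y) _.
  apply/fsubset_leq_card/fsubsetP => z; rewrite in_cone !inE in_ball => yz.
  by rewrite yz andbT; have := dtri o y z; lia.
have [->|[y]] := fset_0Vmem [fset y in sphere o m |
    (d y z <= n) && (gprod d y o z <= k)].
  by rewrite cardfs0.
rewrite !inE /= => /and3P[/andP[_ /eqP oy] yz oyz].
rewrite (card_ball o y); apply/fsubset_leq_card/fsubsetP => y'.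
rewrite in_ball !inE /= => /and3P[/andP[_ /eqP oy'] y'z oy'z].
(* Both [y] and [y'] have product at least [2 * m - k] with [z] at [o], so [d y y' <= k + K]. *)
have := d_hyp o y z y'; move: oyz oy'z; rewrite /gprod.
have := dtri o y z; have := dtri o y' z; have := dtri o z y.
have := dtri o z y'; have := dC o y; have := dC o y'; have := dC z y.
have := dC z y'; have := dtri y o z; have := dtri y' o z.
by have := dtri y o y'; lia.
Qed.

(** The factors pay for replacing a ball by a cone, for the overlap of cones, and for the extra
    radius [(2 * k).+1]. *)
Lemma card_sphereM o m n :
  #|` sphere o m| * #|` ball o n| <=
  2 * #|` ball o (k + K)| * #|` ball o (2 * k).+1| * #|` ball o (m + n)|.
Proof.
have half y : uphalf #|` ball o n| <= #|` cone o y (n + (2 * k).+1)|.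
  by have := card_ball_le_cone n o y; rewrite (card_ball o y); lia.
have := card_sphere_cone m half; rewrite addnA.
have := card_ballD o (m + n) (2 * k).+1; have := half o.
set b := #|` ball o n|; have : b <= 2 * uphalf b by lia.
by nia.
Qed.

Lemma card_ball_exponential (R : realType) o : exists lambda C : R,
  [/\ (1 < lambda)%R, (1 < C)%R & forall n : nat,
    (C^-1 * lambda ^+ n <= #|` ball o n|%:R <= C * lambda ^+ n)%R].
Proof.
apply: (@pure_exponential R (fun n => #|` ball o n|) (fun m => #|` sphere o m|)
  _ k.+1 _ _ (card_ballD o) (card_sphereM o) (card_ball_sphere o)) => // [|j].
  by rewrite cardfs_gt0; apply/fset0Pn; exists o; rewrite in_ball dxx.
apply: leq_trans (exp2_le_card_cone j o o) _.
by apply/fsubset_leq_card/fsubsetP => z; rewrite in_cone in_ball => /andP[].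
Qed.

End Growth.

(** * The path metric on the geometric realization *)

Section PathMetric.
Local Open Scope ring_scope.
Variables (R : realType) (X : graph).
Implicit Types (p q r : realization R X) (e : edge X) (u v w : vert X).

Local Notation vpt := (vertex_pt R).
Local Notation dist := (@path_dist R X).

Lemma edge_pt0 e : edge_pt e (0 : R) = vpt (src e).
Proof. by rewrite /edge_pt insubF ?ltxx ?lexx. Qed.

Lemma edge_pt1 e : edge_pt e (1 : R) = vpt (tgt e).
Proof. by rewrite /edge_pt insubF ?ltxx ?andbF // ler10. Qed.

Lemma edge_pt_in e (t : {t : R | 0 < t < 1}) : edge_pt e (val t) = inr (e, t).
Proof. by rewrite /edge_pt valK. Qed.

Lemma unit_intervalP (t : R) : 0 <= t <= 1 ->
  [\/ t = 0, t = 1 | exists t' : {t : R | 0 < t < 1}, t = val t'].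
Proof.
move=> /andP[]; rewrite !le_eqVlt => /orP[/eqP<-|t0]; first by constructor 1.
move=> /orP[/eqP->|t1]; first by constructor 2.
have t01 : 0 < t < 1 by rewrite t0.
by constructor 3; exists (exist _ t t01).
Qed.

Lemma pl_path_cat p q r s t :
  pl_path p q s -> pl_path q r t -> pl_path p r (s ++ t).
Proof.
elim: s p => [|[e [a b]] s IH] p /=; first by move->.
by move=> [a01 b01 <- sq] tr; split => //; apply: IH.
Qed.

Lemma pl_length_cat (s t : seq (edge X * (R * R))) :
  pl_length (s ++ t) = pl_length s + pl_length t.
Proof. by rewrite /pl_length big_cat. Qed.

Lemma pl_length_cons e (a b : R) s :
  pl_length ((e, (a, b)) :: s) = `|b - a| + pl_length s :> R.
Proof. by rewrite /pl_length big_cons. Qed.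

Lemma pl_length_nil : @pl_length R X [::] = 0.
Proof. by rewrite /pl_length big_nil. Qed.

Lemma pl_length_ge0 (s : seq (edge X * (R * R))) : 0 <= pl_length s.
Proof. by rewrite /pl_length sumr_ge0. Qed.

Lemma pl_path_rev p q s : pl_path p q s ->
  exists2 t, pl_path q p t & pl_length t = pl_length s.
Proof.
elim: s p => [|[e [a b]] s IH] p /=; first by move->; exists [::].
move=> [a01 b01 <- /IH[t tp ts]].
exists (t ++ [:: (e, (b, a))]).
  by apply: pl_path_cat tp _; split.
by rewrite pl_length_cat ts !pl_length_cons pl_length_nil addr0 addrC distrC.
Qed.

Hypothesis conn : graph_connected R X.

Lemma path_dist_le p q s : pl_path p q s -> dist p q <= pl_length s.
Proof.
move=> pq; apply: ge_inf; last by exists s.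
by exists 0 => _ [t _ <-]; apply: pl_length_ge0.
Qed.

(** Connectedness excludes the default infimum 0 of the empty set. *)
Lemma path_dist_ge p q (m : R) :
  (forall s, pl_path p q s -> m <= pl_length s) -> m <= dist p q.
Proof.
move=> h; apply: lb_le_inf.
  by have [s pq] := conn p q; exists (pl_length s), s.
by move=> _ [s pq <-]; apply: h.
Qed.

Lemma path_dist_ge0 p q : 0 <= dist p q.
Proof. by apply: path_dist_ge => s _; apply: pl_length_ge0. Qed.

Lemma path_dist_tri p q r : dist p r <= dist p q + dist q r.
Proof.
rewrite -lerBlDr; apply: path_dist_ge => s pq.
rewrite lerBlDr -lerBlDl; apply: path_dist_ge => t qr.
by rewrite lerBlDl -pl_length_cat; apply/path_dist_le/(pl_path_cat pq).
Qed.

Lemma path_distC p q : dist p q = dist q p.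
Proof.
suff h p' q' : dist p' q' <= dist q' p' by apply/le_anti; rewrite !h.
apply: path_dist_ge => s /pl_path_rev[t pq <-]; exact: path_dist_le.
Qed.

Lemma path_dist_edge e (a b : R) : 0 <= a <= 1 -> 0 <= b <= 1 ->
  dist (edge_pt e a) (edge_pt e b) <= `|b - a|.
Proof.
move=> a01 b01; have -> : `|b - a| = pl_length [:: (e, (a, b))].
  by rewrite pl_length_cons pl_length_nil addr0.
by apply: path_dist_le; split.
Qed.

Lemma path_dist_xx p : dist p p = 0.
Proof.
apply/le_anti; rewrite path_dist_ge0 andbT.
by rewrite -pl_length_nil; apply: path_dist_le.
Qed.

(** * Edge walks and the combinatorial distance *)

(* The step [(e, true)] runs through [e] backwards, from [tgt e] to [src e]. *)
Definition step_src (i : edge X * bool) := if i.2 then tgt i.1 else src i.1.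
Definition step_tgt (i : edge X * bool) := if i.2 then src i.1 else tgt i.1.

Fixpoint walk v w (s : seq (edge X * bool)) : Prop :=
  if s is i :: s' then step_src i = v /\ walk (step_tgt i) w s' else v = w.

Lemma walk_cat u v w s t : walk u v s -> walk v w t -> walk u w (s ++ t).
Proof.
elim: s u => [|i s IH] u /=; first by move->.
by move=> [-> sv] tw; split => //; apply: IH.
Qed.

Lemma walk_take_drop u w s n : walk u w s -> (n <= size s)%N ->
  exists2 v, walk u v (take n s) & walk v w (drop n s).
Proof.
elim: n u s => [|n IH] u s; first by rewrite take0 drop0; exists u.
case: s => // i s [iu /IH h] /h[v uv vw]; exists v => //; by split.
Qed.

Lemma walk_rev u v s : walk u v s -> exists2 t, walk v u t & size t = size s.
Proof.
elim: s u => [|i s IH] u /=; first by move->; exists [::].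
move=> [<- /IH[t vt <-]]; exists (t ++ [:: (i.1, ~~ i.2)]).
  by apply: walk_cat vt _; rewrite /= /step_src /step_tgt /=; case: i.2.
by rewrite size_cat addn1.
Qed.

Definition base_vert p : vert X :=
  match p with inl v => v | inr (e, _) => src e end.

Lemma base_vert_edge e (t : R) : 0 <= t <= 1 ->
  base_vert (edge_pt e t) = src e \/ base_vert (edge_pt e t) = tgt e.
Proof.
move=> /unit_intervalP[->|->|[t' ->]]; rewrite ?edge_pt0 ?edge_pt1 ?edge_pt_in.
- by left.
- by right.
- by left.
Qed.

(** Each linear piece stays in one edge, so the base vertices of its ends are equal or joined by
    that edge. *)
Lemma walk_exists u v : exists s, walk u v s.
Proof.
have [s] := conn (vpt u) (vpt v); rewrite -[u]/(base_vert (vpt u)).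
move: (vpt u) => p; rewrite -[v]/(base_vert (vpt v)); move: (vpt v) => q.
elim: s p => [|[e [a b]] s IH] p /=; first by move->; exists [::].
move=> [a01 b01 <- /IH[t bt]].
suff [t' ab] :
    exists t', walk (base_vert (edge_pt e a)) (base_vert (edge_pt e b)) t'.
  by exists (t' ++ t); apply: walk_cat ab bt.
have [->|->] := base_vert_edge e a01; have [->|->] := base_vert_edge e b01.
- by exists [::].
- by exists [:: (e, false)].
- by exists [:: (e, true)].
- by exists [::].
Qed.

Fact ex_walk_size u v :
  exists n, (fun n => `[< exists2 s, walk u v s & size s = n >]) n.
Proof.
by have [s uv] := walk_exists u v; exists (size s); apply/asboolP; exists s.
Qed.

Definition vdist u v : nat := ex_minn (ex_walk_size u v).

Lemma geodesic_walk u v : exists2 s, walk u v s & size s = vdist u v.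
Proof. by rewrite /vdist; case: ex_minnP => n /asboolP. Qed.

Lemma vdist_le u v s : walk u v s -> (vdist u v <= size s)%N.
Proof.
rewrite /vdist; case: ex_minnP => n _ nmin uv.
by apply: nmin; apply/asboolP; exists s.
Qed.

Lemma vdistxx u : vdist u u = 0%N.
Proof. by have := @vdist_le u u [::] erefl; rewrite leqn0 => /eqP. Qed.

Lemma vdistC u v : vdist u v = vdist v u.
Proof.
suff h u' v' : (vdist u' v' <= vdist v' u')%N by apply/eqP; rewrite eqn_leq !h.
have [s /walk_rev[t uv <-] <-] := geodesic_walk v' u'; exact: vdist_le.
Qed.

Lemma vdist_tri u v w : (vdist u w <= vdist u v + vdist v w)%N.
Proof.
have [s uv <-] := geodesic_walk u v; have [t vw <-] := geodesic_walk v w.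
by rewrite -size_cat; apply/vdist_le/(walk_cat uv vw).
Qed.

Lemma vdist_geod u w n : (n <= vdist u w)%N ->
  exists2 v, vdist u v = n & vdist v w = (vdist u w - n)%N.
Proof.
have [s us sz] := geodesic_walk u w; rewrite -sz => ns.
have [v uv vw] := walk_take_drop us ns; exists v.
  have := vdist_le uv; have := vdist_le vw; have := vdist_tri u v w.
  rewrite size_takel // size_drop; lia.
have := vdist_le uv; have := vdist_le vw; have := vdist_tri u v w.
rewrite size_takel // size_drop; lia.
Qed.

Lemma vdist_edge e v :
  (vdist v (tgt e) <= (vdist v (src e)).+1)%N /\
  (vdist v (src e) <= (vdist v (tgt e)).+1)%N.
Proof.
have le1 : (vdist (src e) (tgt e) <= 1)%N.
  by rewrite -[1%N]/(size [:: (e, false)]) vdist_le.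
have := vdist_tri v (src e) (tgt e); have := vdist_tri v (tgt e) (src e).
by have := vdistC (src e) (tgt e); lia.
Qed.

(** An explicit candidate for the distance to [v], entering an edge by either end. Being 1-Lipschitz
    along edges, it bounds path lengths from below. *)
Definition dist_from v p : R :=
  match p with
  | inl u => (vdist v u)%:R
  | inr (e, t) => Num.min ((vdist v (src e))%:R + val t)
                          ((vdist v (tgt e))%:R + 1 - val t)
  end.

Lemma dist_from_edge v e (t : R) : 0 <= t <= 1 ->
  dist_from v (edge_pt e t) =
    Num.min ((vdist v (src e))%:R + t) ((vdist v (tgt e))%:R + 1 - t).
Proof.
have [st ts] := vdist_edge e v.
move=> /unit_intervalP[->|->|[t' ->]];
  rewrite ?edge_pt0 ?edge_pt1 ?edge_pt_in //=.
  by rewrite addr0 subr0 min_l // natr1 ler_nat.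
by rewrite addrK min_r // natr1 ler_nat.
Qed.

Lemma dist_from_lipschitz v e (a b : R) : 0 <= a <= 1 -> 0 <= b <= 1 ->
  dist_from v (edge_pt e b) <= dist_from v (edge_pt e a) + `|b - a|.
Proof.
move=> a01 b01; rewrite !dist_from_edge //.
have ab := ler_norm (b - a); have ba := ler_norm (a - b); rewrite distrC in ba.
set x := _ + b; set y := _ - b; set x1 := _ + a; set y1 := _ - a.
by have [] := lerP x y; have [] := lerP x1 y1; rewrite /x /y /x1 /y1; lra.
Qed.

Lemma vdist_le_pl_length v q s : pl_path (vpt v) q s ->
  dist_from v q <= pl_length s.
Proof.
suff h p : pl_path p q s -> dist_from v q <= dist_from v p + pl_length s.
  by move/h; rewrite /= vdistxx add0r.
elim: s p => [|[e [a b]] s IH] p /=.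
  by move->; rewrite pl_length_nil addr0.
move=> [a01 b01 <- /IH bq]; rewrite pl_length_cons addrA.
by apply: le_trans bq _; rewrite lerD2r dist_from_lipschitz.
Qed.

Lemma path_dist_vertex_le u v s :
  walk u v s -> dist (vpt u) (vpt v) <= (size s)%:R.
Proof.
elim: s u => [|i s IH] u /=; first by move->; rewrite path_dist_xx.
move=> [<- /IH h]; apply: le_trans (path_dist_tri _ (vpt (step_tgt i)) _) _.
rewrite -natr1 addrC lerD // /step_src /step_tgt; case: i.2.
  rewrite -edge_pt0 -edge_pt1; apply: le_trans (path_dist_edge _ _ _) _.
  - by rewrite ler01 lexx.
  - by rewrite ler01 lexx.
  by rewrite sub0r normrN normr1.
rewrite -edge_pt0 -edge_pt1; apply: le_trans (path_dist_edge _ _ _) _.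
- by rewrite ler01 lexx.
- by rewrite ler01 lexx.
by rewrite subr0 normr1.
Qed.

Lemma path_dist_vertex u v : dist (vpt u) (vpt v) = (vdist u v)%:R.
Proof.
apply/le_anti/andP; split.
  by have [s uv <-] := geodesic_walk u v; apply: path_dist_vertex_le.
by apply: path_dist_ge => s; apply: vdist_le_pl_length.
Qed.

Lemma path_dist_base_vert p : dist p (vpt (base_vert p)) <= 1.
Proof.
case: p => [v|[e t]] /=; first by rewrite path_dist_xx.
have /andP[t0 t1] := valP t.
rewrite -edge_pt0 -edge_pt_in; apply: le_trans (path_dist_edge _ _ _) _.
- by rewrite !ltW.
- by rewrite lexx ler01.
by rewrite sub0r normrN ger0_norm ltW.
Qed.

(** * Geodesic segments from shortest walks *)

Definition step_pt (i : edge X * bool) (t : R) : realization R X :=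
  edge_pt i.1 (if i.2 then 1 - t else t).

Lemma step_pt0 i : step_pt i 0 = vpt (step_src i).
Proof.
by rewrite /step_pt /step_src; case: i.2; rewrite ?subr0 ?edge_pt0 ?edge_pt1.
Qed.

Lemma step_pt1 i : step_pt i 1 = vpt (step_tgt i).
Proof.
by rewrite /step_pt /step_tgt; case: i.2; rewrite ?subrr ?edge_pt0 ?edge_pt1.
Qed.

Lemma path_dist_step i (a b : R) : 0 <= a <= 1 -> 0 <= b <= 1 ->
  dist (step_pt i a) (step_pt i b) <= `|b - a|.
Proof.
move=> a01 b01; rewrite /step_pt; case: i.2; last exact: path_dist_edge.
have -> : b - a = - ((1 - b) - (1 - a)) by lra.
by rewrite normrN path_dist_edge //; lra.
Qed.

(** Unit speed parametrization of a walk; at the junction [t = 1] both branches agree, by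
    [walk_pt_cons]. *)
Fixpoint walk_pt v (s : seq (edge X * bool)) (t : R) : realization R X :=
  if s is i :: s' then
    if t <= 1 then step_pt i t else walk_pt (step_tgt i) s' (t - 1)
  else vpt v.

Lemma walk_pt0 u v s : walk u v s -> walk_pt u s 0 = vpt u.
Proof. by case: s => [|i s] //= [<- _]; rewrite ler01 step_pt0. Qed.

Lemma walk_pt_cons u v i s (t : R) : walk u v (i :: s) -> 1 <= t ->
  walk_pt u (i :: s) t = walk_pt (step_tgt i) s (t - 1).
Proof.
move=> [_ sv] t1 /=; case: ifP => // t1'.
have -> : t = 1 by lra.
by rewrite subrr step_pt1 (walk_pt0 sv).
Qed.

Lemma walk_pt_size u v w s t : walk u v s -> walk v w t ->
  walk_pt u (s ++ t) (size s)%:R = vpt v.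
Proof.
elim: s u => [|i s IH] u; first by move=> -> vw; rewrite (walk_pt0 vw).
move=> us vw; have st := walk_cat us vw.
rewrite cat_cons (walk_pt_cons st); last by rewrite ler1n.
by rewrite /= -natr1 addrK; case: us => _ sv; apply: IH.
Qed.

Lemma walk_pt_lipschitz u v s (a b : R) : walk u v s ->
  0 <= a -> a <= b -> b <= (size s)%:R ->
  dist (walk_pt u s a) (walk_pt u s b) <= b - a.
Proof.
elim: s u a b => [|i s IH] u a b.
  by move=> _ a0 ab b0 /=; rewrite path_dist_xx; lra.
move=> us a0 ab; rewrite /= -natr1 => bs; have [_ sv] := us.
have [b1|b1] := leP b 1.
  have a1 : a <= 1 by lra.
  rewrite a1; apply: le_trans (path_dist_step _ _ _) _; [lra|lra|].
  by rewrite ger0_norm; lra.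
have [a1|a1] := leP a 1; last first.
  by apply: le_trans (IH _ _ _ sv _ _ _) _; lra.
apply: le_trans (path_dist_tri _ (step_pt i 1) _) _.
have -> : b - a = `|1 - a| + (b - 1 - 0) by rewrite ger0_norm; lra.
rewrite lerD //; first by apply: path_dist_step; lra.
by rewrite step_pt1 -(walk_pt0 sv) IH //; lra.
Qed.

Definition segment u s : set (realization R X) :=
  [set walk_pt u s t | t in [set t : R | 0 <= t <= (size s)%:R]]%classic.

Lemma walk_pt_end u v s : walk u v s -> walk_pt u s (size s)%:R = vpt v.
Proof. by move=> us; rewrite -{1}[s]cats0; apply: (@walk_pt_size u v v). Qed.

Lemma geodesic_walk_segment u v s : walk u v s -> size s = vdist u v ->
  geodesic_segment dist (vpt u) (vpt v) (segment u s).
Proof.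
move=> us sz; exists (size s)%:R, (walk_pt u s); split => //.
- exact: walk_pt0 us.
- exact: walk_pt_end us.
suff h a b : 0 <= a -> a <= b -> b <= (size s)%:R ->
    dist (walk_pt u s a) (walk_pt u s b) = b - a.
  move=> a b /andP[a0 aL] /andP[b0 bL]; have [ab|/ltW ba] := leP a b.
    by rewrite h // distrC ger0_norm // subr_ge0.
  by rewrite path_distC h // ger0_norm // subr_ge0.
(* The three pieces have length at most their parameter length, and these add up to the full
   distance, so equality holds. *)
move=> a0 ab bL; apply/le_anti; rewrite (walk_pt_lipschitz us) //=.
have := walk_pt_lipschitz us (lexx 0) a0 (le_trans ab bL).
have := walk_pt_lipschitz us (le_trans a0 ab) bL (lexx _).
have := path_dist_tri (walk_pt u s 0) (walk_pt u s a) (walk_pt u s (size s)%:R).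
have := path_dist_tri (walk_pt u s a) (walk_pt u s b) (walk_pt u s (size s)%:R).
rewrite (walk_pt0 us) (walk_pt_end us) path_dist_vertex -sz.
lra.
Qed.

(** Rounding the parameter down gives a vertex of a shortest walk. *)
Lemma segment_near_vertex u v s q : walk u v s -> size s = vdist u v ->
  segment u s q ->
  exists2 w, between vdist u w v & dist q (vpt w) <= 1.
Proof.
move=> us sz [t /andP[t0 tL] <-].
have /andP[nt tn] := Num.Theory.truncn_itv t0.
set n := Num.truncn t in nt tn.
have nL : (n <= size s)%N by rewrite -(ler_nat R); lra.
have [w uw wv] := walk_take_drop us nL.
exists w.
  have := vdist_le uw; have := vdist_le wv; have := vdist_tri u w v.
  by rewrite size_takel // size_drop /between; lia.
have := walk_pt_size uw wv; rewrite cat_take_drop size_takel // => <-.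
rewrite path_distC; apply: le_trans (walk_pt_lipschitz us _ _ _) _ => //.
by rewrite -natr1 in tn; lra.
Qed.

Lemma between_on_segment x m y : between vdist x m y ->
  exists s, [/\ walk x y s, size s = vdist x y & segment x s (vpt m)].
Proof.
move=> xpy; have [s xp sz] := geodesic_walk x m.
have [t py tz] := geodesic_walk m y; exists (s ++ t); split.
- exact: walk_cat xp py.
- by rewrite size_cat sz tz.
exists (size s)%:R; last exact: walk_pt_size xp py.
by rewrite /= ler0n ler_nat size_cat leq_addr.
Qed.

(** Passing from a nearby point of a side to a vertex costs 1; [Num.bound] makes the constant an
    integer. *)
Lemma vdist_slim delta : gromov_hyperbolic dist delta ->
  forall x y z m, between vdist x m y ->
  exists2 w, (vdist m w <= Num.bound (delta + 1))%N &
    between vdist x w z \/ between vdist y w z.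
Proof.
move=> hyp x y z m /between_on_segment[s [xy sxy sp]].
have [t yz tz] := geodesic_walk y z; have [r zx rz] := geodesic_walk z x.
have [sub _ _] := hyp _ _ _ _ _ _ (geodesic_walk_segment xy sxy)
  (geodesic_walk_segment yz tz) (geodesic_walk_segment zx rz).
have [q qtr pq] := sub _ sp.
have near w : dist q (vpt w) <= 1 -> (vdist m w <= Num.bound (delta + 1))%N.
  move=> qw; rewrite -(ler_nat R) -path_dist_vertex.
  have := path_dist_tri (vpt m) q (vpt w).
  have d1 : dist (vpt m) q + dist q (vpt w) <= delta + 1 by lra.
  have := archi_boundP (le_trans (addr_ge0 (path_dist_ge0 _ _)
    (path_dist_ge0 _ _)) d1); lra.
case: qtr => [/(segment_near_vertex yz tz)|/(segment_near_vertex zx rz)].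
  by move=> [w yw /near pw]; exists w => //; right.
move=> [w zw /near pw]; exists w => //; left; move: zw; rewrite /between.
by rewrite (vdistC z w) (vdistC z x) (vdistC w x); lia.
Qed.

Lemma automorphism_vdist fV fE : automorphism (X := X) fV fE ->
  forall u v, vdist (fV u) (fV v) = vdist u v.
Proof.
(* Walks map to walks, steps being reversed along with their edges; the inverse automorphism gives
   the other inequality. *)
have le gV gE u v : automorphism (X := X) gV gE ->
    (vdist (gV u) (gV v) <= vdist u v)%N.
  move=> [_ _ gP]; have [s uv <-] := geodesic_walk u v.
  suff [t gt <-] : exists2 t, walk (gV u) (gV v) t & size t = size s.
    exact: vdist_le.
  elim: s u uv => [|i s IH] u /=; first by move->; exists [::].
  move=> [<- /IH[t tv <-]].
  suff [j [js jt]] : exists j, step_src j = gV (step_src i) /\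
      step_tgt j = gV (step_tgt i).
    by exists (j :: t) => //; split => //; rewrite jt.
  case: i {tv} => e b; case: (gP e) => [[es et]|[es et]].
    by exists (gE e, b); rewrite /step_src /step_tgt /=; case: b.
  by exists (gE e, ~~ b); rewrite /step_src /step_tgt /=; case: b.
move=> fP u v; apply/eqP; rewrite eqn_leq (le _ _ _ _ fP) /=.
case: (fP) => -[gV fVK gVK] [gE fEK gEK] fe.
have gP : automorphism (X := X) gV gE.
  split; [by exists fV|by exists fE|move=> e].
  by rewrite -{2 4 6 8}(gEK e); case: (fe (gE e)) => [[-> ->]|[-> ->]];
    rewrite !fVK; [left|right].
by rewrite -{1}(fVK u) -{1}(fVK v) (le _ _ _ _ gP).
Qed.

Lemma vertex_ballE (x : vert X) n :
  vertex_ball R x n = [set v | (vdist x v <= n)%N]%classic.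
Proof.
by apply/seteqP; split=> v; rewrite /vertex_ball /= path_dist_vertex ler_nat.
Qed.

(** The next ball is covered by the ends of the edges at the previous ball. *)
Lemma finite_vertex_ball (x : vert X) n :
  finite_valence X -> finite_set (vertex_ball R x n).
Proof.
move=> fin; elim: n => [|n IH].
  apply: (@sub_finite_set _ _ [set x]%classic); last exact: finite_set1.
  rewrite vertex_ballE => v /=; have [s xv <-] := geodesic_walk x v.
  by rewrite leqn0 => /nilP s0; rewrite s0 in xv.
pose E u := [set e : edge X | src e = u \/ tgt e = u]%classic.
apply: (@sub_finite_set _ _ (vertex_ball R x n `|`
    \bigcup_(u in vertex_ball R x n)
      (@src X @` E u `|` @tgt X @` E u))%classic).
  rewrite !vertex_ballE => v /= xv; have [|xv'] := leqP (vdist x v) n.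
    by left.
  right; have [|u xu uv] := @vdist_geod x v n; first by lia.
  exists u; first by rewrite /= xu.
  have uv1 : vdist u v = 1%N by lia.
  have [s + sz] := geodesic_walk u v; move: sz; rewrite uv1.
  case: s => [|[e b] [|]] //= _ [eu ev].
  case: b eu ev; rewrite /step_src /step_tgt /= => eu ev.
    by left; exists e => //; right.
  by right; exists e => //; left.
rewrite finite_setU; split=> //; apply: bigcup_finite => // u _.
by rewrite finite_setU; split; apply: finite_image; apply: fin.
Qed.

End PathMetric.

(** * Quasi-isometries to a point and to a line *)

Section QuasiIsometry.
Local Open Scope ring_scope.
Variables (R : realType) (X : graph).
Hypothesis conn : graph_connected R X.

Local Notation dist := (@path_dist R X).
Local Notation vdist := (vdist conn).

Lemma path_dist_base_vert_le (p q : realization R X) :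
  dist p q <= (vdist (base_vert p) (base_vert q))%:R + 2.
Proof.
have := path_dist_tri conn p (vertex_pt R (base_vert p)) q.
have := path_dist_tri conn (vertex_pt R (base_vert p))
  (vertex_pt R (base_vert q)) q.
have := path_dist_base_vert conn p; have := path_dist_base_vert conn q.
by rewrite (path_distC conn q) -path_dist_vertex; lra.
Qed.

Lemma base_vert_path_dist_le (p q : realization R X) :
  (vdist (base_vert p) (base_vert q))%:R <= dist p q + 2.
Proof.
have := path_dist_tri conn (vertex_pt R (base_vert p)) p
  (vertex_pt R (base_vert q)).
have := path_dist_tri conn p q (vertex_pt R (base_vert q)).
have := path_dist_base_vert conn p; have := path_dist_base_vert conn q.
by rewrite (path_distC conn p (vertex_pt _ _)) -path_dist_vertex; lra.
Qed.

(** Otherwise the realization has diameter at most [2 * n + 2], and the constant map is a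
    quasi-isometry. *)
Lemma vdist_unbounded : ~ quasi_isometric dist (@point_dist R) ->
  forall (o : vert X) (n : nat), exists u, (n <= vdist o u)%N.
Proof.
move=> not_point o n; apply: contrapT => /forallNP bounded; apply: not_point.
exists (fun=> tt), 1, ((2 * n)%:R + 2); split=> //.
- by rewrite addr_ge0.
- move=> p q; rewrite /point_dist invr1 !mul1r.
  rewrite addr_ge0 ?path_dist_ge0 ?addr_ge0 // andbT subr_le0.
  apply: le_trans (path_dist_base_vert_le p q) _; rewrite lerD2r ler_nat.
  have := bounded (base_vert p); have := bounded (base_vert q).
  have := vdist_tri conn (base_vert p) o (base_vert q).
  by have := vdistC conn (base_vert p) o; lia.
- by move=> []; exists (vertex_pt R o); rewrite /point_dist addr_ge0.
Qed.

(** The map is the signed distance to [o]. The sum of truncated differences is an absolute value,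
    and the extra 2 pays for [base_vert]. *)
Lemma quasi_isometric_line (o : vert X) (side : pred (vert X)) (C : nat) :
  (forall u v, side u = side v ->
    vdist u v <= (vdist o u - vdist o v) + (vdist o v - vdist o u) + C)%N ->
  (forall u v, side u != side v -> vdist o u + vdist o v <= vdist u v + C)%N ->
  (forall l, C < 2 * l -> exists2 u, side u & vdist o u = l)%N ->
  (forall l, C < 2 * l -> exists2 u, ~~ side u & vdist o u = l)%N ->
  quasi_isometric dist (@line_dist R).
Proof.
move=> same diff right_end left_end.
pose f u : R := if side u then (vdist o u)%:R else - (vdist o u)%:R.
have fd u v : (vdist u v)%:R - C%:R <= `|f u - f v| <= (vdist u v)%:R + C%:R.
  have tuv : (vdist o u)%:R <= (vdist o v)%:R + (vdist u v)%:R :> R.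
    by rewrite -natrD ler_nat (vdistC conn u) vdist_tri.
  have tvu : (vdist o v)%:R <= (vdist o u)%:R + (vdist u v)%:R :> R.
    by rewrite -natrD ler_nat vdist_tri.
  have tou : (vdist u v)%:R <= (vdist o u)%:R + (vdist o v)%:R :> R.
    by rewrite -natrD ler_nat (vdistC conn o u) vdist_tri.
  have C0 : 0 <= C%:R :> R by [].
  have [e|e] := eqVneq (side u) (side v).
    have -> : `|f u - f v| = `|(vdist o u)%:R - (vdist o v)%:R|.
      by rewrite /f e; case: ifP => // _; rewrite -opprD normrN.
    have := same u v e; case: (leqP (vdist o u) (vdist o v)) => uv.
      rewrite distrC ger0_norm ?subr_ge0 ?ler_nat // (eqP uv) add0n.
      rewrite -(ler_nat R) natrD natrB // => h; lra.
    rewrite ger0_norm ?subr_ge0 ?ler_nat ?(ltnW uv) //.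
    have /eqP -> := ltnW uv.
    rewrite addn0 -(ler_nat R) natrD natrB ?(ltnW uv) // => h; lra.
  have h : (vdist o u)%:R + (vdist o v)%:R <= (vdist u v)%:R + C%:R :> R.
    by rewrite -!natrD ler_nat diff.
  have -> : `|f u - f v| = (vdist o u)%:R + (vdist o v)%:R.
    move: e; rewrite /f; case: (side u); case: (side v) => // _.
      by rewrite opprK ger0_norm // addr_ge0.
    by rewrite -opprD normrN ger0_norm // addr_ge0.
  by lra.
exists (f \o @base_vert R X), 1, (C%:R + 2); split=> //.
- by rewrite addr_ge0.
- move=> p q; rewrite /line_dist /= invr1 !mul1r.
  have := path_dist_base_vert_le p q; have := base_vert_path_dist_le p q.
  by have := fd (base_vert p) (base_vert q); lra.
(* Coarse surjectivity: a vertex at distance [l] on the side given by the sign of [t], or [o] itself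
   if [l] is small. *)
- move=> t; have /andP[] := Num.Theory.truncn_itv (normr_ge0 t).
  set l := Num.truncn _ => lt tl; rewrite -natr1 in tl.
  have [Cl|lC] := ltnP C (2 * l); last first.
    exists (vertex_pt R o).
    rewrite /line_dist /= /f vdistxx oppr0 if_same subr0.
    have : l%:R <= C%:R :> R by rewrite ler_nat; lia.
    by lra.
  have [t0|t0] := leP 0 t.
    have [u su ou] := right_end _ Cl; exists (vertex_pt R u).
    rewrite ger0_norm // in lt tl.
    rewrite /line_dist /= /f su ou ger0_norm ?subr_ge0 //.
    by have : 0 <= C%:R :> R by []; lra.
  have [u su ou] := left_end _ Cl; exists (vertex_pt R u).
  rewrite ltr0_norm // in lt tl.
  rewrite /line_dist /= /f (negPf su) ou opprK -normrN ger0_norm; last by lra.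
  by have : 0 <= C%:R :> R by []; lra.
Qed.

End QuasiIsometry.

(** * Growth of hyperbolike graphs *)

Local Open Scope fset_scope.
Local Open Scope ring_scope.

Theorem theorem4p1 (R : realType) (delta : R) (X : graph) (x : vert X)
  (delta_ge0 : 0 <= delta)
  (X_hyperbolike : hyperbolike delta X)
  (X_not_point : ~ quasi_isometric (@path_dist R X) (@point_dist R))
  (X_not_line : ~ quasi_isometric (@path_dist R X) (@line_dist R)) :
  exists lambda C : R,
    [/\ 1 < lambda, 1 < C
      & forall n : nat,
          C^-1 * lambda ^+ n <= #|` fset_set (vertex_ball R x n)|%:R
            <= C * lambda ^+ n].
Proof.
have [conn fin hyp trans] := X_hyperbolike.
have d_hyp := gprod_hyperbolic (vdistxx conn) (vdistC conn) (vdist_tri conn)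
  (@vdist_geod R X conn) (@vdist_slim R X conn delta hyp).
have d_trans u v : exists g : vert X -> vert X,
    [/\ injective g, g u = v
      & forall y z, vdist conn (g y) (g z) = vdist conn y z].
  have [fV [fE [fP <-]]] := trans u v; exists fV; split => //.
    by case: fP => /bij_inj.
  exact: (automorphism_vdist conn fP).
have d_unbounded := vdist_unbounded conn X_not_point.
apply: (card_ball_exponential (ball := fun o n => fset_set (vertex_ball R o n))
  (vdistxx conn) (vdistC conn) (vdist_tri conn) (@vdist_geod R X conn)
  d_hyp d_trans).
  (* Without fat triples of size [N], the signed coordinate would make [X] a quasi-line. *)
  move=> N; apply: contrapT => thin; apply: X_not_line.
  have thin3 y z w : (gprod (vdist conn) y z w < N \/
      gprod (vdist conn) z w y < N \/ gprod (vdist conn) w y z < N)%N.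
    have [yN|] := leqP N (gprod (vdist conn) y z w); last by left.
    have [zN|] := leqP N (gprod (vdist conn) z w y); last by right; left.
    have [wN|] := leqP N (gprod (vdist conn) w y z); last by right; right.
    by case: thin; exists y, z, w.
  have [side [same diff right_end left_end]] := line_coordinate
    (vdistC conn) (vdist_tri conn) (@vdist_geod R X conn) d_hyp d_trans
    thin3 d_unbounded x.
  exact: (quasi_isometric_line same diff right_end left_end).
(* Finiteness makes [fset_set] the genuine ball rather than a default value. *)
move=> o n z; rewrite in_fset_set; last exact: finite_vertex_ball.
rewrite (vertex_ballE conn).
by apply/idP/idP => [/set_mem|oz] //; apply/mem_set.
Qed.
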